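(* Let $(X_n)$ be generated by the $\lambda$-SAGA algorithm (defined in the context) with fixed $\lambda\in[0,1]$ and step $\gamma_n=c/n^\alpha$, where $c>0$ and $1/2<\alpha\le1$. Assume: (A1) $f$ is continuously differentiable with a unique $x^*$ such that $\nabla f(x^* )=0$; (A3) there is $L>0$ with $\frac1N\sum_{k=1}^N\|\nabla f_k(x)-\nabla f_k(x^* )\|^2\le L\|x-x^*\|^2$ for all $x$; (A5) there is $\mu>0$ with $\langle x-x^*,\nabla f(x)\rangle\ge\mu\|x-x^*\|^2$ for all $x$. Suppose $2c\mu\le2^\alpha$, and additionally $2c\mu>1$ if $\alpha=1$. Then there exists $K>0$ such that for all $n\ge1$, $\mathbb E\big[\|X_n-x^*\|^2\big]\le K/n^\alpha$.
   Context: Let $N,d\ge1$ be integers, $f_1,\dots,f_N:\mathbb R^d\to\mathbb R$ differentiable, and $f=\frac1N\sum_{k=1}^N f_k$. The $\lambda$-SAGA algorithm with parameter $\lambda\in[0,1]$ and positive deterministic steps $(\gamma_n)_{n\ge1}$: let $X_0,X_1$ be square-integrable random vectors in $\mathbb R^d$ and $(U_n)_{n\ge2}$ i.i.d. uniform on $\{1,\dots,N\}$, independent of $(X_0,X_1)$. Set $g_{1,k}=\nabla f_k(X_0)$ for $k=1,\dots,N$ and for $n\ge1$: $X_{n+1}=X_n-\gamma_n\Big(\nabla f_{U_{n+1}}(X_n)-\lambda\big(g_{n,U_{n+1}}-\frac1N\sum_{k=1}^N g_{n,k}\big)\Big)$, and $g_{n+1,k}=\nabla f_k(X_n)$ if $U_{n+1}=k$,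 $g_{n+1,k}=g_{n,k}$ otherwise. *)

(* Defs.v *)
From HB Require Import structures.
From mathcomp Require Import all_boot all_order all_algebra.
From mathcomp Require Import all_classical all_reals all_analysis.
Set Implicit Arguments. Unset Strict Implicit. Unset Printing Implicit Defensive.
Import Order.TTheory GRing.Theory Num.Theory.
Import numFieldNormedType.Exports.
Local Open Scope classical_set_scope.
Local Open Scope ring_scope.

Section SagaDefs.
Variable R : realType.
Variable dim : nat.
Local Notation vec := 'rV[R]_dim.

Definition dotv (u v : vec) : R := \sum_(i < dim) u 0 i * v 0 i.
Definition sqnorm (v : vec) : R := \sum_(i < dim) (v 0 i) ^+ 2.

Definition grad (f : vec -> R) (x : vec) : vec :=
  \row_(i < dim) 'D_(delta_mx 0 i) f x.

Variable N : nat.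

Definition avgf (F : 'I_N -> vec -> R) : vec -> R :=
  fun x => N%:R^-1 * \sum_(k < N) F k x.

(* lambda-SAGA, deterministic in (x0, x1, u).  saga_state m is the pair
   (X_{m+1}, g_{m+1,.}) ; gam n is the step gamma_n. *)
Variables (F : 'I_N -> vec -> R) (lam : R) (gam : nat -> R).

Fixpoint saga_state (x0 x1 : vec) (u : nat -> 'I_N) (m : nat)
  : vec * ('I_N -> vec) :=
  match m with
  | 0 => (x1, fun k => grad (F k) x0)
  | m'.+1 =>
      let s := saga_state x0 x1 u m' in
      let x := s.1 in let g := s.2 in
      let n := m'.+1 in
      let k0 := u n.+1 in
      (x - gam n *: (grad (F k0) x - lam *: (g k0 - N%:R^-1 *: \sum_(k < N) g k)),
       fun k => if k == k0 then grad (F k) x else g k)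
  end.

Definition saga_X (x0 x1 : vec) (u : nat -> 'I_N) (n : nat) : vec :=
  match n with 0 => x0 | n'.+1 => (saga_state x0 x1 u n').1 end.

End SagaDefs.

Section Randomness.
Context {R : realType} {d : measure_display} {T : measurableType d}.
Variables (dim N : nat) (P : probability T R).
Variables (X0 X1 : T -> 'rV[R]_dim) (U : nat -> T -> 'I_N).

Definition coords01 (i : 'I_(dim + dim)) (w : T) : R :=
  match fintype.split i with inl j => X0 w 0 j | inr j => X1 w 0 j end.

Definition sigma01 : set (set T) := g_sigma_preimage coords01.

Definition sq_integrable_rvec (X : T -> 'rV[R]_dim) : Prop :=
  (forall i, measurable_fun setT (fun w => X w 0 i)) /\
  (\int[P]_w (sqnorm (X w))%:E < +oo)%E.

(* (U_n)_{n>=2} i.i.d. uniform on 'I_N (= {1..N}), independent of (X0,X1):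
   U_n measurable for n >= 2, and for every event A in sigma(X0,X1), every m
   and all values u_2,...,u_{m+1}:
   P(A /\ U_2 = u_2 /\ ... /\ U_{m+1} = u_{m+1}) = P(A) * (1/N)^m. *)
Definition iid_uniform_indep : Prop :=
  (forall n k, (2 <= n)%N -> measurable (U n @^-1` [set k])) /\
  forall A, sigma01 A -> forall (m : nat) (u : nat -> 'I_N),
    P (A `&` \bigcap_(j in [set j | (2 <= j < m + 2)%N]) (U j @^-1` [set u j]))
    = (P A * ((N%:R^-1) ^+ m)%:E)%E.

End Randomness.

(* Main.v *)
Require Import Defs.
From HB Require Import structures.
From mathcomp Require Import all_boot all_order all_algebra.
From mathcomp Require Import all_classical all_reals all_analysis.
From mathcomp Require Import measurable_realfun ring lra.
Set Implicit Arguments. Unset Strict Implicit. Unset Printing Implicit Defensive.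
Import Order.TTheory GRing.Theory Num.Theory.
Import numFieldNormedType.Exports.
Local Open Scope classical_set_scope.
Local Open Scope ring_scope.

(** Conditional expectations given [(X0, X1)] are averages over finitely many index
    paths of deterministic functions of [(X0, X1)], so everything reduces to the means
    of [e = |x - xstar|^2] and of the table error [A = mean_k |g_k - grad f_k xstar|^2] after [m] uniform
    steps from a deterministic state.  Both are bounded linearly in
    [1 + |X0 - xstar|^2 + |X1 - xstar|^2]: if at some time they are at most [M] and
    [L M] with [M >= 1], then the next step gives [A' <= L M] and
    [e' <= (1 - 2 mu gamma) e + O(gamma^2) M], which is again at most [M] once
    [gamma] is small.  With [e] bounded, the same recursion gives the rate
    [n^(-alpha)] by Chung's argument, and one integrates over [(X0, X1)]. *)

(** * Chung's recursion *)

Lemma powRn_unbounded (R : realType) (b M : R) : 0 < b ->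
  exists n0 : nat, forall m, (n0 <= m)%N -> M <= m.+1%:R `^ b.
Proof.
move=> b0; pose x := Num.max M 0 `^ b^-1.
have x0 : 0 <= x by exact: powR_ge0.
exists (Num.truncn x) => m hm.
have hx : x <= m.+1%:R.
  apply/ltW; have := truncnS_gt x => /lt_le_trans; apply.
  by rewrite ler_nat.
apply: (@le_trans _ _ (x `^ b)).
  rewrite /x -powRrM mulVf ?gt_eqF// powRr1 ?le_max ?lexx ?orbT//.
by apply: ge0_ler_powR; rewrite ?nnegrE//; exact: ltW.
Qed.

(** A base that is at least 1 does not grow when raised to a power [alpha <= 1]; here the base is
    [1 + n.+1%:R^-1]. *)
Lemma powRnS_ratio (R : realType) (alpha : R) (n : nat) : 0 < alpha <= 1 ->
  n.+2%:R `^ alpha <= n.+1%:R `^ alpha * (1 + n.+1%:R^-1).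
Proof.
move=> /andP[a0 a1].
have -> : n.+2%:R = n.+1%:R * (1 + n.+1%:R^-1) :> R.
  by rewrite mulrDr mulr1 divff// -natr1.
have h : 0 <= n.+1%:R^-1 :> R by rewrite invr_ge0.
rewrite powRM//.
rewrite ler_wpM2l ?powR_ge0// -[leRHS]powRr1 ?addr_ge0//.
by apply: ler_powR => //; rewrite lerDl.
Qed.

(** With n = [m.+1], the ratio is n^(alpha-1). It tends to 0 if [alpha < 1], so [delta] can be
    [a / 2]; it is constantly 1 if [alpha = 1], where [1 < a] leaves [delta = a - 1]. *)
Lemma chung_gap (R : realType) (a alpha : R) : 0 < a -> alpha <= 1 ->
  (alpha = 1 -> 1 < a) -> exists2 delta, 0 < delta &
  exists n0 : nat, forall m, (n0 <= m)%N ->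
    delta <= a - m.+1%:R `^ alpha / m.+1%:R.
Proof.
move=> a0; rewrite le_eqVlt => /orP[/eqP -> /(_ erefl) a1|a1 _].
  exists (a - 1); first by rewrite subr_gt0.
  by exists 0 => m _; rewrite powRr1// divff.
exists (a / 2); first by rewrite divr_gt0.
have [|n0 h] := @powRn_unbounded R (1 - alpha) (2 / a); first by rewrite subr_gt0.
exists n0 => m /h {}h.
have m0 : 0 < m.+1%:R :> R by [].
have e : m.+1%:R `^ alpha / m.+1%:R = (m.+1%:R `^ (1 - alpha))^-1 :> R.
  rewrite -powRN opprB powRD; last by apply/implyP => _; rewrite gt_eqF.
  by rewrite powR_inv1.
have : (m.+1%:R `^ (1 - alpha))^-1 <= (2 / a)^-1.
  by rewrite lef_pV2// posrE ?powR_gt0 ?divr_gt0.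
rewrite e invf_div => {}h; lra.
Qed.

(* A bound [M] of [e m] and [A m / L] persists up to the factor [1 + D], and without
   loss once [m] is large, so both sequences are bounded linearly in [B]; the rate
   then follows from [delta <= a - m.+1%:R `^ alpha / m.+1%:R]. *)
Lemma chung_rate (R : realType) (a D L alpha : R) :
  0 < a -> 0 <= D -> 0 <= L -> 0 < alpha <= 1 -> (alpha = 1 -> 1 < a) ->
  exists2 K, 0 < K & forall (e A : nat -> R) (B : R), 1 <= B ->
    e 0 <= B -> A 0 <= L * B -> (forall m, 0 <= e m) ->
    (forall m M, 1 <= M -> e m <= M -> A m <= L * M ->
       e m.+1 <= (1 - a / m.+1%:R `^ alpha) * e m + D / (m.+1%:R `^ alpha) ^+ 2 * M
       /\ A m.+1 <= L * M) ->
  forall m, e m <= K * B / m.+1%:R `^ alpha.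
Proof.
move=> a0 D0 L0 /andP[al0 al1] ha.
have [delta d0 [n1 hn1]] := chung_gap a0 al1 ha.
(* Beyond [n2] the factor 1 - a/t is nonnegative and the noise D/t^2 is at most the contraction
   a/t. *)
have [n2 hn2] := @powRn_unbounded R alpha (Num.max a (D / a)) al0.
pose t (m : nat) : R := m.+1%:R `^ alpha.
have t1 m : 1 <= t m.
  have -> : 1 = 1 `^ alpha by rewrite powR1.
  by rewrite /t ge0_ler_powR ?nnegrE ?(ltW al0)// ler1n.
have t0 m : 0 < t m by apply: lt_le_trans (t1 m).
pose n0 := maxn n1 n2; pose Q := (1 + D) ^+ n0.
have q1 : 1 <= 1 + D by rewrite lerDl.
have Q1 : 1 <= Q by apply: exprn_ege1.
have Q0 : 0 < Q by apply: lt_le_trans Q1.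
(* The first summand covers the times up to [n0], where [e m <= Q * B] and [t m <= t n0]; the second
   gives [D * Q <= K * delta], which drives the induction after [n0]. *)
pose K := Q * t n0 + D * Q / delta.
have K0 : 0 < K by rewrite ltr_wpDr ?mulr_gt0// divr_ge0 ?mulr_ge0// ltW.
exists K => // e A B B1 e0 A0 ege0 rec m.
have B0 : 0 < B by apply: lt_le_trans B1.
(* Crude growth, valid at every time: the first coefficient is at most 1 and the second at most [D],
   since [1 <= t k]. *)
have grow k : e k <= (1 + D) ^+ k * B /\ A k <= L * ((1 + D) ^+ k * B).
  elim: k => [|k [IHe IHA]]; first by rewrite expr0 mul1r.
  set M := (1 + D) ^+ k * B in IHe IHA.
  have M1 : 1 <= M by rewrite -[1]mulr1 ler_pM// exprn_ege1.
  have M0 : 0 <= M by apply: le_trans M1.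
  have [r1 r2] := rec k M M1 IHe IHA.
  have eM : (1 + D) ^+ k.+1 * B = (1 + D) * M by rewrite exprS mulrA.
  rewrite eM; split; last first.
    by apply: (le_trans r2); rewrite ler_wpM2l// ler_peMl.
  apply: (le_trans r1); rewrite -/(t k) [leRHS]mulrDl mul1r lerD//.
    apply: le_trans IHe; rewrite ler_piMl// gerBl divr_ge0// ltW//.
  rewrite ler_wpM2r// ler_pdivrMr ?exprn_gt0// ler_peMr//.
  by rewrite exprn_ege1.
have big k : (n0 <= k)%N -> a <= t k /\ D / t k <= a.
  rewrite geq_max => /andP[_ /hn2]; rewrite ge_max => /andP[h1 h2].
  by split=> //; rewrite ler_pdivrMr// mulrC -ler_pdivrMr.
(* After [n0] the new bound is a convex combination of copies of [Q * B], so nothing is lost any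
   more. *)
have bnd k : e (n0 + k)%N <= Q * B /\ A (n0 + k)%N <= L * (Q * B).
  have QB1 : 1 <= Q * B by rewrite -[1]mulr1 ler_pM.
  have QB0 : 0 <= Q * B by apply: le_trans QB1.
  elim: k => [|k [IHe IHA]]; first by rewrite addn0; exact: grow.
  rewrite addnS; have [r1 r2] := rec _ _ QB1 IHe IHA.
  split=> //; apply: (le_trans r1); rewrite -/(t _).
  have [h1 h2] := big (n0 + k)%N (leq_addr _ _).
  have c0 : 0 <= 1 - a / t (n0 + k)%N by rewrite subr_ge0 ler_pdivrMr// mul1r.
  apply: (@le_trans _ _ ((1 - a / t (n0 + k)%N) * (Q * B) + a / t (n0 + k)%N * (Q * B))).
    rewrite lerD ?ler_wpM2l// ler_wpM2r// expr2 invfM mulrA.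
    by rewrite ler_wpM2r// invr_ge0 ltW.
  by rewrite -mulrDl subrK mul1r.
have [mn|nm] := leqP m n0.
  have [h _] := grow m; apply: (le_trans h).
  rewrite ler_pdivlMr// -/(t m) mulrAC ler_wpM2r ?(ltW B0)//.
  apply: (@le_trans _ _ (Q * t n0)).
    apply: ler_pM; rewrite ?exprn_ge0 ?addr_ge0 ?(ltW (t0 _))//.
      by rewrite /Q ler_weXn2l.
    by rewrite /t ge0_ler_powR ?nnegrE ?(ltW al0)// ler_nat.
  by rewrite lerDl divr_ge0 ?mulr_ge0// ltW.
rewrite -(subnKC (ltnW nm)); elim: (m - n0)%N => [|k IH].
  rewrite addn0 ler_pdivlMr// -/(t n0).
  have [h _] := grow n0.
  apply: (@le_trans _ _ (Q * t n0 * B)).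
    by rewrite mulrAC ler_wpM2r// ltW.
  by rewrite ler_wpM2r ?(ltW B0)// lerDl divr_ge0 ?mulr_ge0// ltW.
rewrite addnS.
have [IHe IHA] := bnd k.
have QB1 : 1 <= Q * B by rewrite -[1]mulr1 ler_pM.
have [r1 _] := rec _ _ QB1 IHe IHA; apply: (le_trans r1).
have [h1 _] := big (n0 + k)%N (leq_addr _ _).
have /hn1 : (n1 <= n0 + k)%N by rewrite (leq_trans (leq_maxl n1 n2)) ?leq_addr.
have := @powRnS_ratio R alpha (n0 + k) _; rewrite al0 al1 => /(_ isT).
have T'0 := t0 (n0 + k).+1; have T0 := t0 (n0 + k)%N.
rewrite -/(t _) -/(t (n0 + k).+1) in r1 IH T'0 T0 h1 *.
set T := t (n0 + k)%N in r1 IH T0 h1 *; set T' := t (n0 + k).+1 in T'0 *.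
set n : R := (n0 + k).+1%:R.
have n_gt0 : 0 < n by [].
have n_ge1 : 1 <= n by rewrite ler1n.
move=> hT hd.
have c0 : 0 <= 1 - a / T by rewrite subr_ge0 ler_pdivrMr// mul1r.
apply: (@le_trans _ _ ((1 - a / T) * (K * B / T) + D / T ^+ 2 * (Q * B))).
  by rewrite lerD2r ler_wpM2l.
(* The margin in this inequality is exactly (K(a - T/n) - DQ) B/T^2, which is nonnegative because a
   - T/n is at least [delta]. *)
apply: (@le_trans _ _ ((1 - n^-1) / T * (K * B))).
  have KQ : D * Q <= K * (a - T / n).
    apply: (@le_trans _ _ (K * delta)); last by rewrite ler_wpM2l// ltW.
    by rewrite mulrDl divfK ?gt_eqF// lerDr !mulr_ge0// ltW.
  rewrite -subr_ge0.
  have -> : (1 - n^-1) / T * (K * B) -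
     ((1 - a / T) * (K * B / T) + D / T ^+ 2 * (Q * B)) =
     (K * (a - T / n) - D * Q) * (B / T ^+ 2).
    by field; rewrite !gt_eqF.
  by rewrite mulr_ge0 ?subr_ge0// divr_ge0 ?exprn_ge0// ltW.
(* Since T' <= T(1 + 1/n), this follows from (1 - 1/n)(1 + 1/n) <= 1. *)
suff hh : (1 - n^-1) / T <= T'^-1.
  by rewrite [leRHS]mulrC ler_wpM2r// mulr_ge0// ltW.
rewrite ler_pdivrMr// [leRHS]mulrC ler_pdivlMr//.
apply: (@le_trans _ _ ((1 - n^-1) * (T * (1 + n^-1)))).
  by rewrite ler_wpM2l// subr_ge0 invf_le1.
rewrite [leLHS](_ : _ = T * (1 - n^-1 ^+ 2)); last by ring.
by rewrite ler_piMr ?(ltW T0)// gerBl exprn_ge0// invr_ge0 ltW.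
Qed.

(** * Squared norms and averages *)

Section Vectors.
Context {R : realType} {dim N : nat}.
Implicit Types (u v w : 'rV[R]_dim) (b y : 'I_N -> 'rV[R]_dim).
Hypothesis N0 : (0 < N)%N.
Local Notation "\avg_ k E" := (N%:R^-1 * \sum_(k < N) E)
  (at level 36, k name, E at level 36).

Lemma sqnorm_ge0 v : 0 <= sqnorm v.
Proof. by apply: sumr_ge0 => i _; rewrite sqr_ge0. Qed.

Lemma dotvC u v : dotv u v = dotv v u.
Proof. by apply: eq_bigr => i _; rewrite mulrC. Qed.

Lemma sqnormZ (a : R) v : sqnorm (a *: v) = a ^+ 2 * sqnorm v.
Proof. by rewrite /sqnorm mulr_sumr; apply: eq_bigr => i _; rewrite mxE exprMn. Qed.

Lemma sqnormD2_le u v : sqnorm (u + v) <= 2 * (sqnorm u + sqnorm v).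
Proof.
rewrite /sqnorm -big_split mulr_sumr; apply: ler_sum => i _; rewrite mxE /=.
have := sqr_ge0 (u 0 i - v 0 i); rewrite !expr2; nra.
Qed.

Lemma sqnormB2_le u v : sqnorm (u - v) <= 2 * (sqnorm u + sqnorm v).
Proof.
have -> : sqnorm v = sqnorm (- v) by rewrite -scaleN1r sqnormZ; ring.
exact: sqnormD2_le.
Qed.

Lemma sqnormB_expand u v (a : R) :
  sqnorm (u - a *: v) = sqnorm u - 2 * a * dotv u v + a ^+ 2 * sqnorm v.
Proof.
rewrite /sqnorm /dotv !mulr_sumr -sumrB -big_split.
by apply: eq_bigr => i _; rewrite !mxE /=; ring.
Qed.

Lemma avg_const (x : R) : \avg_k x = x.
Proof.
by rewrite sumr_const card_ord -[x *+ N]mulr_natl mulKf// pnatr_eq0 -lt0n.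
Qed.

Lemma dotv_avg u y : dotv u (N%:R^-1 *: \sum_(k < N) y k) = \avg_k (dotv u (y k)).
Proof.
rewrite /dotv exchange_big mulr_sumr; apply: eq_bigr => i _.
by rewrite !mxE summxE -mulr_sumr mulrCA.
Qed.

(** The difference of the two sides is a variance, the mean of |b_k - m|^2 with m the average of the
    b_k. *)
Lemma sqnorm_avg_le b :
  sqnorm (N%:R^-1 *: \sum_(k < N) b k) <= \avg_k (sqnorm (b k)).
Proof.
set m := _ *: _.
(* The scalar [1] brings the difference into the shape of [sqnormB_expand]. *)
have h : \avg_k (sqnorm (b k - 1 *: m)) = \avg_k (sqnorm (b k)) - sqnorm m.
  have -> : \avg_k (sqnorm (b k - 1 *: m))
          = \avg_k (sqnorm m - 2 * dotv m (b k) + sqnorm (b k)).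
    congr (_ * _); apply: eq_bigr => k _.
    by rewrite sqnormB_expand (dotvC m); ring.
  rewrite big_split sumrB /= mulrDr mulrBr avg_const -mulr_sumr mulrCA.
  rewrite -dotv_avg -/m.
  have -> : dotv m m = sqnorm m by apply: eq_bigr => i _; rewrite expr2.
  by ring.
rewrite -subr_ge0 -h mulr_ge0 ?invr_ge0// sumr_ge0// => k _.
exact: sqnorm_ge0.
Qed.

End Vectors.

(** * Measurability and averages of gradients *)

(** A preimage under [g \o q] is a countable union of fibres of [q], whatever [g] is. *)
Lemma measurable_fun_count (d d' : measure_display) (T : measurableType d)
    (T' : measurableType d') (I : countType) (q : T -> I) (g : I -> T') :
  (forall i, measurable (q @^-1` [set i])) -> measurable_fun setT (g \o q).
Proof.
move=> mq _ B mB; rewrite setTI.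
have -> : (g \o q) @^-1` B = \bigcup_i (if g i \in B then q @^-1` [set i] else set0).
  apply/seteqP; split=> [x /= Bx|x [i _]].
    by exists (q x) => //; rewrite mem_set.
  by case: ifPn => // /set_mem gB /= ->.
apply: countable_bigcupT_measurable; first exact: countableP.
by move=> i; case: ifP.
Qed.

Lemma cvg_floor_div (R : realType) (x : R) :
  (Num.floor (n.+1%:R * x))%:~R / n.+1%:R @[n --> \oo] --> x.
Proof.
apply: (@squeeze_cvgr _ _ _ _ (fun n : nat => x - n.+1%:R^-1) (fun=> x)).
- near=> n.
  have n0 : 0 < n.+1%:R :> R by [].
  apply/andP; split.
    rewrite ler_pdivlMr// mulrBl mulVf ?gt_eqF// lerBlDr mulrC.
    by apply/ltW; rewrite -intrD1 floorD1_gt.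
  by rewrite ler_pdivrMr// [leRHS]mulrC floor_le.
- rewrite -[X in _ --> X]subr0; apply: cvgB; first exact: cvg_cst.
  exact: cvg_harmonic.
- exact: cvg_cst.
Unshelve. all: by end_near. Qed.

(* ['rV[R]_dim] carries no measurable structure: a continuous function of a
   coordinatewise measurable map is the limit of its values on the grids
   [Z^dim / n], each of which factors through a countable type. *)
Lemma measurable_comp_continuous_rV (R : realType) (dim : nat)
    (d : measure_display) (T : measurableType d) (f : 'rV[R]_dim -> R)
    (X : T -> 'rV[R]_dim) : continuous f ->
  (forall i, measurable_fun setT (fun w => X w 0 i)) ->
  measurable_fun setT (fun w => f (X w)).
Proof.
move=> cf mX.
pose q (n : nat) w : 'rV[int]_dim := \row_i Num.floor (n.+1%:R * X w 0 i).
pose v (n : nat) (z : 'rV[int]_dim) : 'rV[R]_dim := \row_i ((z 0 i)%:~R / n.+1%:R).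
apply: (@measurable_realfun.measurable_fun_cvg _ _ _ _ (fun n => (f \o v n) \o q n)) => [n|w _].
  apply: measurable_fun_count => z.
  have -> : q n @^-1` [set z] = \bigcap_(i in [set: 'I_dim])
      ((fun w => n.+1%:R * X w 0 i) @^-1` `[(z 0 i)%:~R, (z 0 i + 1)%:~R[%classic).
    apply/seteqP; split=> [w /= <- i _ /=|w h /=].
      by rewrite mxE in_itv /= floor_le floorD1_gt.
    apply/rowP => i; rewrite mxE; apply: floor_def.
    by have := h i Logic.I; rewrite /= in_itv.
  apply: fin_bigcap_measurable => // i _; rewrite -[X in measurable X]setTI.
  apply: (_ : measurable_fun setT _) => //.
  exact: measurable_funM.
apply: continuous_cvg; first exact: cf.
apply/cvgrPdist_lt => e e0.
have : \forall n \near \oo, forall i, `|X w 0 i - v n (q n w) 0 i| < e.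
  apply: filter_forall => i; have /cvgrPdist_lt/(_ _ e0) := @cvg_floor_div R (X w 0 i).
  by apply: filterS => n; rewrite !mxE.
apply: filterS => n hn.
rewrite [X in X < _]/Num.norm /= mx_normrE.
by apply/bigmax_ltP; split=> // -[i0 i] _ /=; rewrite ord1 !mxE; have := hn i; rewrite !mxE.
Qed.

(** Replaces the limit over real increments by one along a sequence, since measurability passes to
    sequential limits. *)
Lemma cvg_derive_seq (R : realType) (dim : nat) (f : 'rV[R]_dim -> R)
    (x v : 'rV[R]_dim) : derivable f x v ->
  n.+1%:R * (f (n.+1%:R^-1 *: v + x) - f x) @[n --> \oo] --> 'D_v f x.
Proof.
move=> /cvg_ex[l hl].
(* The derivative is a limit along the punctured neighbourhoods of 0, so the increments must also be
   nonzero. *)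
have h0 : (n.+1%:R^-1 : R) @[n --> \oo] --> (0 : R)^'.
  move=> A [e /= e0 hA].
  have /cvgr0Pnorm_lt/(_ _ e0) := @cvg_harmonic R.
  apply: filterS => n hn; apply: hA; last by rewrite /= invr_neq0.
  by rewrite /ball_ /= sub0r normrN.
have := cvg_comp _ _ h0 hl; rewrite /derive (cvg_lim _ hl)//.
apply: cvg_trans; apply: near_eq_cvg; near=> n.
by rewrite /= invrK.
Unshelve. all: by end_near. Qed.

(** The gradient of a differentiable function may be discontinuous. Its coordinates are pointwise
    limits of difference quotients, which are continuous in the point. *)
Lemma measurable_grad (R : realType) (dim : nat) (f : 'rV[R]_dim -> R)
    (d : measure_display) (T : measurableType d) (X : T -> 'rV[R]_dim) :
  (forall x, differentiable f x) ->
  (forall i, measurable_fun setT (fun w => X w 0 i)) ->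
  forall i, measurable_fun setT (fun w => grad f (X w) 0 i).
Proof.
move=> df mX i.
have cf : continuous f by move=> x; exact: differentiable_continuous.
pose e : 'rV[R]_dim := delta_mx 0 i.
apply: (@measurable_realfun.measurable_fun_cvg _ _ _ _
  (fun n w => n.+1%:R * (f (n.+1%:R^-1 *: e + X w) - f (X w)))) => [n|w _].
  apply: measurable_funM => //; apply: measurable_funB.
    apply: measurable_comp_continuous_rV => // j.
    by under eq_fun do rewrite mxE; exact: measurable_funD.
  exact: measurable_comp_continuous_rV.
by rewrite mxE; apply: cvg_derive_seq; exact: diff_derivable.
Qed.

Lemma grad_avgf (R : realType) (dim N : nat) (F : 'I_N -> 'rV[R]_dim -> R) x :
  (forall k x, differentiable (F k) x) ->
  grad (avgf F) x = N%:R^-1 *: \sum_(k < N) grad (F k) x.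
Proof.
move=> dF; apply/rowP => i; rewrite !mxE summxE.
have dd k : derivable (F k) x (delta_mx 0 i) by exact: diff_derivable.
have -> : avgf F = N%:R^-1 \*: (\sum_(k < N) F k).
  by apply/funext => y; rewrite /avgf /= fct_sumE.
rewrite deriveZ; last exact: derivable_sum.
by rewrite derive_sum//; congr (_ * _); apply: eq_bigr => k _; rewrite mxE.
Qed.

(** * Recursions driven by i.i.d. uniform indices *)

Lemma measurable_fun_bigsetU (d d' : measure_display) (T : measurableType d)
    (T' : measurableType d') (I : Type) (r : seq I) (F : I -> set T) (f : T -> T') :
  (forall i, measurable (F i)) -> (forall i, measurable_fun (F i) f) ->
  measurable_fun (\big[setU/set0]_(i <- r) F i) f.
Proof.
move=> mF mf; elim: r => [|i r IH]; first by rewrite big_nil; exact: measurable_fun_set0.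
rewrite big_cons; apply/measurable_funU => //; exact: bigsetU_measurable.
Qed.

Section Independence.
Context {R : realType} {d : measure_display} {T : measurableType d}.
Variables (P : {measure set T -> \bar R}) (G : set (set T)).
Hypothesis subG : <<s G>> `<=` measurable.

(* Both sides are integrals over the coarser measurable space [<<s G>>], against the
   image of [P] restricted to [A] and against [p] times the image of [P]; these two
   measures coincide. *)
Lemma ge0_integral_indep (A : set T) (p : R) (h : T -> \bar R) :
  measurable A -> 0 <= p ->
  (forall B, <<s G>> B -> P (B `&` A) = (P B * p%:E)%E) ->
  measurable_fun (setT : set (g_sigma_algebraType G)) h ->
  (forall x, 0 <= h x)%E ->
  (\int[P]_(x in A) h x = p%:E * \int[P]_x h x)%E.
Proof.
move=> mA p0 PA mh h0.
pose iota : T -> g_sigma_algebraType G := id.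
have miota : measurable_fun setT iota by move=> _ B mB; rewrite setTI; exact: subG.
have mhT : measurable_fun (setT : set T) h by exact: (measurableT_comp mh miota).
transitivity (\int[mrestr P mA]_(x in A) h x)%E.
  apply: eq_measure_integral => B mB BA.
  by rewrite /= /mrestr setIidl.
transitivity (\int[mrestr P mA]_x h x)%E.
  rewrite [RHS](@ge0_negligible_integral _ _ _ _ setT (~` A))//.
  - by rewrite setTD setCK.
  - exact: measurableC.
  - by rewrite /= /mrestr setICl measure0.
have h0' : {in setT, forall y : g_sigma_algebraType G, (0 <= h y)%E} by move=> y _.
have e1 := ge0_integral_pushforward miota (mrestr P mA) measurableT mh h0'.
have e2 := ge0_integral_pushforward miota P measurableT mh h0'.
apply: (etrans (esym e1)); apply: etrans (congr1 (mule p%:E) e2).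
rewrite -(ge0_integral_mscale _ measurableT (NngNum p0))//.
apply: eq_measure_integral => B mB _.
by rewrite /= /mscale /pushforward /= /mrestr muleC; exact: PA.
Qed.

End Independence.

Section IidRecursion.
Context {R : realType} {N : nat} {S : Type}.
Variable step : nat -> 'I_N -> S -> S.
Implicit Types (s : S) (u : nat -> 'I_N) (phi : S -> R).

(** State number m' of SAGA carries X_n with n = m'+1, and the step from it draws U_(n+1); hence the
    index [m'.+2]. *)
Fixpoint iter_path s u (m : nat) : S :=
  if m is m'.+1 then step m' (u m'.+2) (iter_path s u m') else s.

(** The transition operator of a time-inhomogeneous Markov chain: the expectation of [phi] after [r]
    uniform draws, starting at time [m] in [s]. *)
Fixpoint mean_after phi (r m : nat) s : R :=
  if r is r'.+1 then
    N%:R^-1 * \sum_(k < N) mean_after phi r' m.+1 (step m k s)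
  else phi s.

Definition upd u (j : nat) (k : 'I_N) : nat -> 'I_N :=
  fun i => if i == j then k else u i.

Lemma eq_iter_path s u v m :
  (forall j, (2 <= j < m + 2)%N -> u j = v j) -> iter_path s u m = iter_path s v m.
Proof.
elim: m => //= m IH h; rewrite (h m.+2) ?addn2 ?ltnSn//; congr (step _ _ _).
by apply: IH => j /andP[j2 jm]; rewrite h// j2 addSn ltnW.
Qed.

Lemma step_iter_path s u m k :
  step m k (iter_path s u m) = iter_path s (upd u m.+2 k) m.+1.
Proof.
rewrite /= /upd eqxx; congr (step _ _ _); apply: eq_iter_path => j /andP[_].
by rewrite addn2; case: eqP => // ->; rewrite ltnn.
Qed.

Lemma mean_after_ge0 phi r m s : (forall s', 0 <= phi s') ->
  0 <= mean_after phi r m s.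
Proof.
move=> phi0; elim: r m s => [|r IH] m s /=; first exact: phi0.
by rewrite mulr_ge0 ?invr_ge0// sumr_ge0.
Qed.

(** The definition splits off the first draw; splitting off the last one lets a one-step estimate
    yield a recursion for the means. *)
Lemma mean_afterS phi r m s : mean_after phi r.+1 m s =
  mean_after (fun s' => N%:R^-1 * \sum_(k < N) phi (step (m + r) k s')) r m s.
Proof.
elim: r m s => [|r IH] m s; first by rewrite /= addn0.
rewrite [LHS]/=; congr (_ * _); apply: eq_bigr => k _.
by rewrite -/(mean_after phi r.+1 m.+1 _) IH addSnnS.
Qed.

Lemma ler_mean_after phi psi r m s : (forall s', phi s' <= psi s') ->
  mean_after phi r m s <= mean_after psi r m s.
Proof.
move=> h; elim: r m s => [|r IH] m s /=; first exact: h.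
by rewrite ler_wpM2l ?invr_ge0// ler_sum.
Qed.

Lemma mean_afterD phi psi r m s :
  mean_after (fun s' => phi s' + psi s') r m s
  = mean_after phi r m s + mean_after psi r m s.
Proof.
elim: r m s => //= r IH m s; rewrite -mulrDr -big_split.
by congr (_ * _); apply: eq_bigr => k _; rewrite IH.
Qed.

Lemma mean_afterZ a phi r m s :
  mean_after (fun s' => a * phi s') r m s = a * mean_after phi r m s.
Proof.
elim: r m s => //= r IH m s; rewrite [RHS]mulrCA.
by congr (_ * _); rewrite mulr_sumr; apply: eq_bigr => k _; rewrite IH.
Qed.

Lemma mean_after_cst a r m s : (0 < N)%N -> mean_after (fun=> a) r m s = a.
Proof.
move=> N0; elim: r m s => //= r IH m s.
by rewrite (eq_bigr (fun=> a)) ?avg_const// => k _; rewrite IH.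
Qed.

Context {d : measure_display} {T : measurableType d}.
Variables (P : {measure set T -> \bar R}) (G : set (set T)) (U : nat -> T -> 'I_N).
Variable s0 : T -> S.

Definition cylinder u m :=
  \bigcap_(j in [set j | (2 <= j < m + 2)%N]) (U j @^-1` [set u j]).

Hypothesis subG : <<s G>> `<=` measurable.
Hypothesis mU : forall n k, (2 <= n)%N -> measurable (U n @^-1` [set k]).
Hypothesis indU : forall A, <<s G>> A -> forall m u,
  P (A `&` cylinder u m) = (P A * ((N%:R^-1) ^+ m)%:E)%E.
Variable phi : S -> R.
Hypothesis phi0 : forall s, 0 <= phi s.
Hypothesis mphi : forall u m, measurable_fun (setT : set (g_sigma_algebraType G))
  (fun w => phi (iter_path (s0 w) u m)).

Lemma measurable_cylinder u m : measurable (cylinder u m).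
Proof. by apply: bigcap_measurableType => j /= /andP[j2 _]; exact: mU. Qed.

Lemma cylinderS u m :
  cylinder u m = \big[setU/set0]_(k < N) cylinder (upd u m.+2 k) m.+1.
Proof.
apply/seteqP; split=> [w Cw|w].
  rewrite -bigcup_seq; exists (U m.+2 w) => /=; first by rewrite mem_index_enum.
  move=> j /= /andP[j2]; rewrite addSn addn2 ltnS leq_eqVlt /upd.
  case: eqP => [->//|_ /= jm]; apply: Cw; by rewrite /= j2 addn2.
rewrite -bigcup_seq => -[k _ Cw] j /= /andP[j2 jm].
have h : (2 <= j < m.+1 + 2)%N by rewrite j2 addSn ltnS ltnW.
have := Cw _ h; rewrite /= /upd.
by case: eqP => // jE; move: jm; rewrite jE addn2 ltnn.
Qed.

Lemma trivIset_cylinderS u m :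
  trivIset setT (fun k : 'I_N => cylinder (upd u m.+2 k) m.+1).
Proof.
move=> k l _ _ [w [wk wl]].
have h : (2 <= m.+2 < m.+1 + 2)%N by rewrite addn2 ltnSn.
by have := wk _ h; have := wl _ h; rewrite /= /upd eqxx => -> ->.
Qed.

Lemma iter_path_cylinder u m w s :
  cylinder u m w -> iter_path s (U ^~ w) m = iter_path s u m.
Proof. by move=> Cw; apply: eq_iter_path => j hj; exact: Cw. Qed.

Lemma measurable_mean_after u m r :
  measurable_fun (setT : set (g_sigma_algebraType G))
    (fun w => mean_after phi r m (iter_path (s0 w) u m)).
Proof.
elim: r m u => [|r IH] m u /=; first exact: mphi.
apply: measurable_funM => //; apply: measurable_sum => k.
by under eq_fun do rewrite step_iter_path; exact: IH.
Qed.

Lemma measurable_fun_sub (f : T -> R) :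
  measurable_fun (setT : set (g_sigma_algebraType G)) f -> measurable_fun setT f.
Proof.
move=> mf _ B mB; rewrite setTI; apply: subG.
by have := mf measurableT B mB; rewrite setTI.
Qed.

(** Splitting by one draw at a time ends in cylinders on which every draw used is frozen; there
    [mphi] applies. *)
Lemma measurable_phi_cylinder u m r :
  measurable_fun (cylinder u m) (fun w => phi (iter_path (s0 w) (U ^~ w) (m + r))).
Proof.
elim: r u m => [|r IH] u m.
  rewrite addn0.
  apply: (@eq_measurable_fun _ _ _ _ _ (fun w => phi (iter_path (s0 w) u m))).
    by move=> w; rewrite inE => Cw; rewrite (iter_path_cylinder _ Cw).
  by apply: measurable_funTS; exact: measurable_fun_sub.
rewrite cylinderS; apply: measurable_fun_bigsetU => k; first exact: measurable_cylinder.
by rewrite -addSnnS; exact: IH.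
Qed.

(** Induction on the number [r] of free draws. With none left the path depends on [s0] alone, and
    independence gives the factor N^(-m). Otherwise the cylinder splits by the next draw into [N]
    pieces, which are averaged as in [mean_after]. *)
Lemma integral_cylinder u m r :
  (\int[P]_(w in cylinder u m) (phi (iter_path (s0 w) (U ^~ w) (m + r)))%:E
   = ((N%:R^-1) ^+ m)%:E * \int[P]_w (mean_after phi r m (iter_path (s0 w) u m))%:E)%E.
Proof.
elim: r u m => [|r IH] u m.
  rewrite addn0.
  rewrite (eq_integral (fun w => (phi (iter_path (s0 w) u m))%:E)); last first.
    by move=> w; rewrite inE => Cw; rewrite (iter_path_cylinder _ Cw).
  rewrite (ge0_integral_indep subG (measurable_cylinder u m) (p := (N%:R^-1) ^+ m))//.
  - by move=> B GB; rewrite indU.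
  - exact/measurable_EFinP.
  - by move=> x; rewrite lee_fin.
have mm : measurable_fun (cylinder u m)
    (fun w => (phi (iter_path (s0 w) (U ^~ w) (m + r.+1)))%:E).
  exact/measurable_EFinP/measurable_phi_cylinder.
rewrite cylinderS ge0_integral_bigsetU//; first last.
- by move=> w _; rewrite lee_fin.
- by rewrite -cylinderS.
- apply: (@sub_trivIset _ _ _ setT) => //; exact: trivIset_cylinderS.
- exact: index_enum_uniq.
- by move=> k; exact: measurable_cylinder.
under eq_bigr do rewrite -addSnnS IH.
rewrite -ge0_sume_distrr; last first.
  by move=> k _; apply: integral_ge0 => w _; rewrite lee_fin; apply: mean_after_ge0.
rewrite -ge0_integral_sum//; last 2 first.
- by move=> k; apply/measurable_EFinP; apply: measurable_fun_sub; exact: measurable_mean_after.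
- by move=> k w _; rewrite lee_fin; apply: mean_after_ge0.
(* One factor 1/N of N^(-(m+1)) becomes the weight of the average over the next draw. *)
rewrite exprS EFinM [(N%:R^-1%:E * _)%E]muleC -muleA; congr (_ * _)%E.
rewrite -ge0_integralZl_EFin//; last 2 first.
- by move=> w _; rewrite sume_ge0// => k _; rewrite lee_fin; apply: mean_after_ge0.
- apply: emeasurable_sum => k.
  by apply/measurable_EFinP; apply: measurable_fun_sub; exact: measurable_mean_after.
apply: eq_integral => w _.
rewrite sumEFin -EFinM; congr (_%:E); congr (_ * _).
by apply: eq_bigr => k _; rewrite step_iter_path.
Qed.

(** The case of no prescribed draw, whose cylinder is the whole space. *)
Lemma integral_iter_path u r :
  measurable_fun setT (fun w => phi (iter_path (s0 w) (U ^~ w) r)) /\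
  (\int[P]_w (phi (iter_path (s0 w) (U ^~ w) r))%:E
   = \int[P]_w (mean_after phi r 0 (s0 w))%:E)%E.
Proof.
have C0 : cylinder u 0 = setT.
  by apply/seteqP; split=> // w _ j /= /andP[j2]; rewrite add0n ltnNge j2.
have := @measurable_phi_cylinder u 0 r; have := @integral_cylinder u 0 r.
by rewrite C0 expr0 mul1e add0n.
Qed.

End IidRecursion.

(** * The SAGA recursion *)

Section Saga.
Context {R : realType} {dim N : nat}.
Variables (F : 'I_N -> 'rV[R]_dim -> R) (lam : R) (gam : nat -> R).
Local Notation vec := 'rV[R]_dim.
Local Notation state := (vec * ('I_N -> vec))%type.
Implicit Types s : state.

(** The draw is an explicit argument so that it can be averaged over. State [m] holds X_(m+1), hence
    the step size [gam m.+1]. *)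
Definition saga_step (m : nat) (k : 'I_N) s : state :=
  (s.1 - gam m.+1 *: (grad (F k) s.1
     - lam *: (s.2 k - N%:R^-1 *: \sum_(j < N) s.2 j)),
   fun j => if j == k then grad (F j) s.1 else s.2 j).

Definition saga_init (x0 x1 : vec) : state := (x1, fun k => grad (F k) x0).

Lemma saga_stateE x0 x1 u m :
  saga_state F lam gam x0 x1 u m = iter_path saga_step (saga_init x0 x1) u m.
Proof. by elim: m => //= m ->. Qed.

Lemma measurable_saga_path (d : measure_display) (T : measurableType d)
    (X0 X1 : T -> vec) u m :
  (forall k x, differentiable (F k) x) ->
  (forall i, measurable_fun setT (fun w => X0 w 0 i)) ->
  (forall i, measurable_fun setT (fun w => X1 w 0 i)) ->
  let s w := iter_path saga_step (saga_init (X0 w) (X1 w)) u m in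
  (forall i, measurable_fun setT (fun w => (s w).1 0 i)) /\
  (forall k i, measurable_fun setT (fun w => (s w).2 k 0 i)).
Proof.
move=> dF mX0 mX1; elim: m => [|m [IH1 IH2]].
  by split=> // k i; exact: measurable_grad.
split=> [i|k i] /=; last first.
  by case: (k == u m.+2) => //; exact: measurable_grad.
have e (x y z : vec) (v : 'I_N -> vec) g a b :
    (x - g *: (y - a *: (z - b *: \sum_(j < N) v j))) 0 i
    = x 0 i - g * (y 0 i - a * (z 0 i - b * \sum_(j < N) v j 0 i)).
  by rewrite !mxE summxE.
under eq_fun do rewrite e.
apply: measurable_funB => //; apply: measurable_funM => //.
apply: measurable_funB; first exact: measurable_grad.
apply: measurable_funM => //; apply: measurable_funB => //.
by apply: measurable_funM => //; apply: measurable_sum.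
Qed.

Lemma measurable_sqnormB (d : measure_display) (T : measurableType d)
    (X : T -> vec) (x : vec) :
  (forall i, measurable_fun setT (fun w => X w 0 i)) ->
  measurable_fun setT (fun w => sqnorm (X w - x)).
Proof.
move=> mX; apply: measurable_sum => i; apply: measurable_funX.
by under eq_fun do rewrite !mxE; exact: measurable_funB.
Qed.

Variables (xs : vec) (mu L : R).
Hypothesis N0 : (0 < N)%N.
Hypothesis dF : forall k x, differentiable (F k) x.
Hypothesis lam01 : 0 <= lam <= 1.
Hypothesis gxs : grad (avgf F) xs = 0.
Hypothesis A3 : forall x,
  N%:R^-1 * \sum_(k < N) sqnorm (grad (F k) x - grad (F k) xs) <= L * sqnorm (x - xs).
Hypothesis A5 : forall x,
  mu * sqnorm (x - xs) <= dotv (x - xs) (grad (avgf F) x).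

Definition sqdist s : R := sqnorm (s.1 - xs).
Definition table_err s : R :=
  N%:R^-1 * \sum_(k < N) sqnorm (s.2 k - grad (F k) xs).
(** By [gxs] these gradients average to zero, so this is the variance of a sampled gradient at
    [xs]. *)
Definition noise : R := N%:R^-1 * \sum_(k < N) sqnorm (grad (F k) xs).

Lemma noise_ge0 : 0 <= noise.
Proof. by rewrite mulr_ge0 ?invr_ge0// sumr_ge0// => k _; exact: sqnorm_ge0. Qed.

(** Each entry is refreshed with probability 1/N, and by [A3] fresh entries have mean error at most
    [L * sqdist s]. *)
Lemma saga_step_table m s :
  N%:R^-1 * \sum_(k < N) table_err (saga_step m k s)
  <= (1 - N%:R^-1) * table_err s + N%:R^-1 * (L * sqdist s).
Proof.
pose a k := sqnorm (grad (F k) s.1 - grad (F k) xs).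
pose b k := sqnorm (s.2 k - grad (F k) xs).
have e k : table_err (saga_step m k s) = table_err s + N%:R^-1 * (a k - b k).
  rewrite /table_err -mulrDr; congr (_ * _).
  rewrite (bigD1 k)//= eqxx [in RHS](bigD1 k)//= -/(a k) -/(b k).
  rewrite (eq_bigr b) => [|j /negbTE ->//]; ring.
under eq_bigr do rewrite e.
rewrite big_split /= mulrDr avg_const// -mulr_sumr sumrB.
have i0 : 0 <= N%:R^-1 :> R by rewrite invr_ge0.
have tb : table_err s = N%:R^-1 * \sum_(k < N) b k by [].
have h : N%:R^-1 * \sum_(k < N) a k <= L * sqdist s by exact: A3.
have := ler_wpM2l i0 h; rewrite !tb; lra.
Qed.

(** Compare everything with the gradients at [xs]: the direction is a sum of four terms, whence the
    factor 4, and the averaged table error is bounded by [table_err s] once more, whence the 2. *)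
Lemma saga_direction_le s :
  N%:R^-1 * \sum_(k < N) sqnorm (grad (F k) s.1
     - lam *: (s.2 k - N%:R^-1 *: \sum_(j < N) s.2 j))
  <= 4 * (L * sqdist s + noise + 2 * table_err s).
Proof.
pose c k := grad (F k) xs.
pose b k := s.2 k - c k.
pose bm := N%:R^-1 *: \sum_(k < N) b k.
have c0 : N%:R^-1 *: \sum_(k < N) c k = 0 by rewrite -grad_avgf.
(* Centring the table at the gradients at [xs] keeps its average, because those gradients average to
   zero. *)
have bmE : bm = N%:R^-1 *: \sum_(j < N) s.2 j.
  by rewrite /bm sumrB scalerBr c0 subr0.
have /andP[l0 l1] := lam01.
have l01 (v : vec) : sqnorm (lam *: v) <= sqnorm v.
  by rewrite sqnormZ ler_piMl ?sqnorm_ge0// exprn_ile1.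
have l01' (v : vec) : sqnorm ((1 - lam) *: v) <= sqnorm v.
  by rewrite sqnormZ ler_piMl ?sqnorm_ge0// exprn_ile1 ?subr_ge0// gerBl.
have hk k : sqnorm (grad (F k) s.1 - lam *: (s.2 k - N%:R^-1 *: \sum_(j < N) s.2 j))
    <= 4 * (sqnorm (grad (F k) s.1 - c k) + sqnorm (c k) + sqnorm (b k) + sqnorm bm).
  have -> : grad (F k) s.1 - lam *: (s.2 k - N%:R^-1 *: \sum_(j < N) s.2 j)
     = (grad (F k) s.1 - c k + (1 - lam) *: c k) - (lam *: b k - lam *: bm).
    rewrite -bmE; apply/rowP => i; rewrite !mxE; ring.
  apply: (le_trans (sqnormB2_le _ _)).
  have := sqnormD2_le (grad (F k) s.1 - c k) ((1 - lam) *: c k).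
  have := sqnormB2_le (lam *: b k) (lam *: bm).
  have := l01 (b k); have := l01 bm; have := l01' (c k); lra.
have := sqnorm_avg_le N0 b; rewrite -/bm -/(table_err s) => hbm.
apply: (@le_trans _ _ (N%:R^-1 * \sum_(k < N)
   4 * (sqnorm (grad (F k) s.1 - c k) + sqnorm (c k) + sqnorm (b k) + sqnorm bm))).
  by rewrite ler_wpM2l ?invr_ge0// ler_sum.
rewrite -mulr_sumr !big_split /= mulrCA !mulrDr avg_const//.
rewrite -/noise -/(table_err s).
have := A3 s.1; rewrite -/(sqdist s); lra.
Qed.

(** Expand the square: the cross term is the drift, controlled by [A5], and the quadratic term is
    [saga_direction_le]. *)
Lemma saga_step_sqdist m s : 0 <= gam m.+1 ->
  N%:R^-1 * \sum_(k < N) sqdist (saga_step m k s)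
  <= (1 - 2 * gam m.+1 * mu) * sqdist s
     + gam m.+1 ^+ 2 * (4 * (L * sqdist s + noise + 2 * table_err s)).
Proof.
move=> g0; set g := gam m.+1.
pose y k := grad (F k) s.1 - lam *: (s.2 k - N%:R^-1 *: \sum_(j < N) s.2 j).
(* The direction is unbiased: the table correction has mean zero over a uniform index. *)
have ym : N%:R^-1 *: \sum_(k < N) y k = grad (avgf F) s.1.
  have hm (v : vec) : \sum_(k < N) N%:R^-1 *: v = v.
    rewrite sumr_const card_ord -scaler_nat scalerA divff ?scale1r//.
    by rewrite pnatr_eq0 -lt0n.
  by rewrite grad_avgf// sumrB -scaler_sumr sumrB hm subrr scaler0 subr0.
have e k : sqdist (saga_step m k s)
    = sqdist s - 2 * g * dotv (s.1 - xs) (y k) + g ^+ 2 * sqnorm (y k).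
  by rewrite -sqnormB_expand /sqdist /= addrAC.
under eq_bigr do rewrite e.
rewrite big_split sumrB /= mulrDr mulrBr avg_const// -!mulr_sumr.
rewrite [_ * (2 * g * _)]mulrCA [_ * (g ^+ 2 * _)]mulrCA -dotv_avg ym.
have h1 := ler_wpM2l (sqr_ge0 g) (saga_direction_le s).
have h2 := ler_wpM2l g0 (A5 s.1); rewrite -/(sqdist s) -/g in h2.
rewrite -/(y _) in h1.
apply: lerD => //; lra.
Qed.

End Saga.

(** [K] is chosen before [x0] and [x1], and the bound is linear in their squared distances, so it
    can be integrated over random starting points. *)
Lemma saga_mean_rate (R : realType) (dim N : nat) (F : 'I_N -> 'rV[R]_dim -> R)
    (lam c alpha mu L : R) (xs : 'rV[R]_dim) :
  (0 < N)%N -> (forall k x, differentiable (F k) x) -> 0 <= lam <= 1 ->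
  0 < c -> 0 < alpha <= 1 -> grad (avgf F) xs = 0 -> 0 < L ->
  (forall x, N%:R^-1 * \sum_(k < N) sqnorm (grad (F k) x - grad (F k) xs)
             <= L * sqnorm (x - xs)) ->
  0 < mu ->
  (forall x, mu * sqnorm (x - xs) <= dotv (x - xs) (grad (avgf F) x)) ->
  (alpha = 1 -> 1 < 2 * c * mu) ->
  exists2 K, 0 < K & forall x0 x1 m,
    mean_after (saga_step F lam (fun m => c / m%:R `^ alpha)) (sqdist xs) m 0
      (saga_init F x0 x1)
    <= K * (1 + sqnorm (x0 - xs) + sqnorm (x1 - xs)) / m.+1%:R `^ alpha.
Proof.
move=> N0 dF lam01 c0 al01 gxs L0 A3 mu0 A5 hal.
pose sigma2 := noise F xs.
have s0 : 0 <= sigma2 by exact: noise_ge0.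
(* Obtained from [saga_direction_le] with [e <= M], [A <= L * M] and [sigma2 <= sigma2 * M]; the
   last uses [1 <= M]. *)
pose D := 4 * c ^+ 2 * (L + sigma2 + 2 * L).
have D0 : 0 <= D.
  have sL0 : 0 <= L + sigma2 + 2 * L by move: L0 s0; lra.
  by rewrite /D !mulr_ge0// ltW.
have a0 : 0 < 2 * c * mu by rewrite !mulr_gt0.
have [K K0 rate] := chung_rate a0 D0 (ltW L0) al01 hal.
exists K => // x0 x1.
set gam := fun m : nat => _; set st := saga_step F lam gam; set z := saga_init F x0 x1.
have gam0 m : 0 <= gam m by rewrite divr_ge0 ?powR_ge0 ?ltW.
apply: (rate (fun m => mean_after st (sqdist xs) m 0 z)
             (fun m => mean_after st (table_err F xs) m 0 z)).
- by rewrite -addrA lerDl addr_ge0 ?sqnorm_ge0.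
- by rewrite /= /sqdist /= lerDr addr_ge0 ?sqnorm_ge0.
(* The initial table consists of gradients at [x0], so [A3] bounds its error; this is how [x0]
   enters the bound. *)
- apply: (le_trans (A3 x0)); rewrite ler_pM2l// addrAC lerDr.
  by rewrite addr_ge0 ?sqnorm_ge0.
- by move=> m; apply: mean_after_ge0 => s; exact: sqnorm_ge0.
move=> m M M1 eM AM; set e := mean_after st (sqdist xs) m 0 z in eM *.
set A := mean_after st (table_err F xs) m 0 z in AM *.
rewrite !mean_afterS add0n; split; last first.
  apply: le_trans (ler_mean_after _ _ _ _ (fun s => saga_step_table lam gam N0 A3 m s)) _.
  rewrite mean_afterD (mean_afterZ _ _ (table_err F xs)).
  rewrite (mean_afterZ _ _ (fun s => L * sqdist xs s)) (mean_afterZ _ L) -/e -/A.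
  have i0 : 0 <= N%:R^-1 :> R by rewrite invr_ge0.
  have i1 : N%:R^-1 <= 1 :> R by rewrite invf_le1 ?ltr0n// ler1n.
  rewrite -subr_ge0 in i1.
  have h1 := ler_wpM2l i1 AM.
  have h2 : N%:R^-1 * (L * e) <= N%:R^-1 * (L * M) by rewrite ler_wpM2l// ler_pM2l.
  by apply: le_trans (lerD h1 h2) _; rewrite -mulrDl subrK mul1r.
apply: le_trans (ler_mean_after _ _ _ _ (fun s =>
  saga_step_sqdist N0 dF lam01 gxs A3 A5 s (gam0 m.+1))) _.
set g := gam m.+1.
have -> : (fun s => (1 - 2 * g * mu) * sqdist xs s
    + g ^+ 2 * (4 * (L * sqdist xs s + sigma2 + 2 * table_err F xs s)))
  = (fun s => ((1 - 2 * g * mu + g ^+ 2 * 4 * L) * sqdist xs s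
      + g ^+ 2 * 8 * table_err F xs s) + g ^+ 2 * 4 * sigma2).
  by apply/funext => s; ring.
rewrite !mean_afterD (mean_afterZ _ _ (table_err F xs)) (mean_afterZ _ _ (sqdist xs)).
rewrite mean_after_cst// -/e -/A.
have T0 : 0 < m.+1%:R `^ alpha by rewrite powR_gt0.
have gE : g = c / m.+1%:R `^ alpha by [].
have -> : 2 * c * mu / m.+1%:R `^ alpha = 2 * g * mu.
  by rewrite gE; field; rewrite gt_eqF.
have -> : D / (m.+1%:R `^ alpha) ^+ 2 = g ^+ 2 * (4 * (L + sigma2 + 2 * L)).
  by rewrite gE /D; field; rewrite gt_eqF.
have g2 : 0 <= g ^+ 2 by exact: sqr_ge0.
have h1 : L * e <= L * M by rewrite ler_pM2l.
have h2 : sigma2 <= sigma2 * M by rewrite ler_peMr.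
have h : L * e + sigma2 + 2 * A <= (L + sigma2 + 2 * L) * M by lra.
have := ler_wpM2l g2 h; lra.
Qed.

(** * Integration over the random starting points *)

Lemma measurable_fun_sigma01 (R : realType) (dim : nat)
    (d : measure_display) (T : measurableType d)
    (X0 X1 : T -> 'rV[R]_dim)
    (G := \big[setU/set0]_(i < dim + dim)
            preimage_set_system setT (coords01 X0 X1 i) measurable) :
  (forall i, measurable_fun (setT : set (g_sigma_algebraType G)) (fun w => X0 w 0 i)) /\
  (forall i, measurable_fun (setT : set (g_sigma_algebraType G)) (fun w => X1 w 0 i)).
Proof.
have mc j : measurable_fun (setT : set (g_sigma_algebraType G)) (coords01 X0 X1 j).
  move=> _ B mB; apply: sub_sigma_algebra; rewrite /G -bigcup_seq.
  by exists j => /=; [rewrite mem_index_enum | exists B].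
split=> i.
- have := mc (lshift dim i); congr (measurable_fun _ _).
  by apply/funext => w; rewrite /coords01 -/(unsplit (inl i)) unsplitK.
- have := mc (rshift dim i); congr (measurable_fun _ _).
  by apply/funext => w; rewrite /coords01 -/(unsplit (inr i)) unsplitK.
Qed.

Theorem theorem3 (R : realType) (dim N : nat) (F : 'I_N -> 'rV[R]_dim -> R)
  (lam c alpha mu L : R) (xstar : 'rV[R]_dim)
  (d : measure_display) (T : measurableType d) (P : probability T R)
  (X0 X1 : T -> 'rV[R]_dim) (U : nat -> T -> 'I_N) :
  (0 < dim)%N -> (0 < N)%N ->
  (forall k x, differentiable (F k) x) ->
  0 <= lam <= 1 -> 0 < c -> 1 / 2 < alpha <= 1 ->
  (* (A1) *)
  (forall x, differentiable (avgf F) x) -> continuous (grad (avgf F)) ->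
  grad (avgf F) xstar = 0 ->
  (forall x, grad (avgf F) x = 0 -> x = xstar) ->
  (* (A3) *)
  0 < L ->
  (forall x, N%:R^-1 * \sum_(k < N) sqnorm (grad (F k) x - grad (F k) xstar)
             <= L * sqnorm (x - xstar)) ->
  (* (A5) *)
  0 < mu ->
  (forall x, mu * sqnorm (x - xstar) <= dotv (x - xstar) (grad (avgf F) x)) ->
  2 * c * mu <= 2 `^ alpha ->
  (alpha = 1 -> 1 < 2 * c * mu) ->
  (* randomness *)
  sq_integrable_rvec P X0 -> sq_integrable_rvec P X1 ->
  iid_uniform_indep P X0 X1 U ->
  exists K : R, 0 < K /\
    forall n : nat, (1 <= n)%N ->
      ('E_P[fun w => sqnorm
          (saga_X F lam (fun m => (c / (m%:R `^ alpha))%R) (X0 w) (X1 w)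
                  (fun j => U j w) n - xstar)%R]
       <= ((K / (n%:R `^ alpha))%R)%:E)%E.
Proof.
move=> _ N0 dF lam01 c0 /andP[al0 al1] _ _ gxs _ L0 A3 mu0 A5 _ hal
  [mX0 iX0] [mX1 iX1] [mU indU].
have al01 : 0 < alpha <= 1 by rewrite al1 andbT; apply: lt_trans al0.
have [K K0 rate] := @saga_mean_rate R dim N F lam c alpha mu L xstar
  N0 dF lam01 c0 al01 gxs L0 A3 mu0 A5 hal.
set gam := fun m : nat => _ in rate.
(* This family generates [sigma01], so [indU] is independence from [<<s G>>]. *)
pose G := \big[setU/set0]_(i < dim + dim)
            preimage_set_system setT (coords01 X0 X1 i) measurable.
have subG : <<s G>> `<=` @measurable _ T.
  apply: smallest_sub; first exact: sigma_algebra_measurable.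
  rewrite /G -bigcup_seq => A [j _ [B mB <-]].
  have mc : measurable_fun setT (coords01 X0 X1 j).
    by rewrite /coords01; case: (fintype.split j) => i; [exact: mX0|exact: mX1].
  exact: mc.
have [mG0 mG1] := measurable_fun_sigma01 X0 X1.
pose st := saga_step F lam gam.
pose z w := saga_init F (X0 w) (X1 w).
have mpath u m : measurable_fun (setT : set (g_sigma_algebraType G))
    (fun w => sqdist xstar (iter_path st (z w) u m)).
  apply: measurable_sqnormB => i.
  exact: (measurable_saga_path lam gam u m dF mG0 mG1).1.
have int m : measurable_fun setT (fun w => sqdist xstar (iter_path st (z w) (U ^~ w) m)) /\
    (\int[P]_w (sqdist xstar (iter_path st (z w) (U ^~ w) m))%:E
     = \int[P]_w (mean_after st (sqdist xstar) m 0 (z w))%:E)%E.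
  apply: (integral_iter_path subG mU indU _ mpath (fun=> Ordinal N0)).
  by move=> s; exact: sqnorm_ge0.
(* The initial bound of [saga_mean_rate] as a random variable; it is integrable because [X0] and
   [X1] are square-integrable. *)
pose W w := 1 + sqnorm (X0 w - xstar) + sqnorm (X1 w - xstar).
have mW : measurable_fun setT W.
  by apply: measurable_funD; [apply: measurable_funD => //|]; exact: measurable_sqnormB.
have W0 w : 0 <= W w by rewrite !addr_ge0 ?sqnorm_ge0.
have cst_fin (r : R) : (\int[P]_w r%:E < +oo)%E.
  rewrite (_ : (\int[P]_w r%:E = r%:E * P setT)%E); last exact: integral_cst.
  by rewrite probability_setT mule1 ltry.
have sq_fin (X : T -> 'rV[R]_dim) : (forall i, measurable_fun setT (fun w => X w 0 i)) ->
    (\int[P]_w (sqnorm (X w))%:E < +oo)%E ->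
    (\int[P]_w (sqnorm (X w - xstar))%:E < +oo)%E.
  move=> mX iX.
  have mS : measurable_fun setT (fun w => (sqnorm (X w))%:E).
    apply/measurable_EFinP; have := measurable_sqnormB 0 mX.
    by under eq_fun do rewrite subr0.
  apply: (@le_lt_trans _ _
    (\int[P]_w (2%:E * (sqnorm (X w))%:E + (2 * sqnorm xstar)%:E))%E).
    apply: ge0_le_integral => //.
    - by move=> w _; rewrite lee_fin sqnorm_ge0.
    - exact/measurable_EFinP/measurable_sqnormB.
    - by apply: emeasurable_funD => //; exact: emeasurable_funM.
    - by move=> w _; rewrite -EFinM -EFinD lee_fin -mulrDr sqnormB2_le.
  rewrite ge0_integralD//; last 3 first.
  - by move=> w _; rewrite -EFinM lee_fin mulr_ge0 ?sqnorm_ge0.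
  - exact: emeasurable_funM.
  - by move=> w _; rewrite lee_fin mulr_ge0 ?sqnorm_ge0.
  rewrite ge0_integralZl_EFin//; last by move=> w _; rewrite lee_fin sqnorm_ge0.
  by rewrite lte_add_pinfty// lte_mul_pinfty.
have Wfin : (\int[P]_w (W w)%:E < +oo)%E.
  under eq_integral do rewrite /W !EFinD.
  rewrite ge0_integralD//; last 4 first.
  - by move=> w _; rewrite -EFinD lee_fin addr_ge0 ?sqnorm_ge0.
  - by apply: emeasurable_funD => //; exact/measurable_EFinP/measurable_sqnormB.
  - by move=> w _; rewrite lee_fin sqnorm_ge0.
  - exact/measurable_EFinP/measurable_sqnormB.
  rewrite ge0_integralD//; last 2 first.
  - by move=> w _; rewrite lee_fin sqnorm_ge0.
  - exact/measurable_EFinP/measurable_sqnormB.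
  by rewrite lte_add_pinfty ?sq_fin// lte_add_pinfty ?sq_fin.
have Wnn : (0 <= \int[P]_w (W w)%:E)%E by apply: integral_ge0 => w _; rewrite lee_fin.
(* Adding 1 makes the constant positive from the nonnegativity of the integral alone. *)
exists (K * (1 + fine (\int[P]_w (W w)%:E))); split.
  by rewrite mulr_gt0// ltr_pwDl// fine_ge0.
(* X_(m+1) is the state after [m] draws, so the rate at [m] already has the denominator
   (m+1)^alpha. *)
case=> // m _.
set T' := m.+1%:R `^ alpha.
have T'0 : 0 < T' by rewrite powR_gt0.
rewrite unlock.
rewrite [leLHS](_ : _ = \int[P]_w (mean_after st (sqdist xstar) m 0 (z w))%:E)%E; last first.
  rewrite -(int m).2; apply: eq_integral => w _.
  by rewrite /= saga_stateE.
apply: (@le_trans _ _ (\int[P]_w ((K / T')%:E * (W w)%:E))%E).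
  apply: ge0_le_integral => //.
  - by move=> w _; rewrite lee_fin; apply: mean_after_ge0 => s; exact: sqnorm_ge0.
  - apply/measurable_EFinP/(measurable_fun_sub subG).
    exact: (measurable_mean_after mpath (fun=> Ordinal N0) 0 m).
  - by apply: emeasurable_funM => //; exact/measurable_EFinP.
  - by move=> w _; rewrite -EFinM lee_fin mulrAC; exact: rate.
rewrite ge0_integralZl_EFin//; last 3 first.
- by move=> w _; rewrite lee_fin.
- exact/measurable_EFinP.
- by rewrite divr_ge0 ?ltW.
rewrite -[X in (_ * X <= _)%E]fineK ?ge0_fin_numE// -EFinM lee_fin.
by rewrite mulrAC ler_wpM2r ?invr_ge0 ?(ltW T'0)// ler_wpM2l ?(ltW K0)// lerDr.
Qed.
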